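(* Let $n\ge 2$, let $F$ be a field of order greater than $2$, and let $\Sigma_n$ be the $n$-dimensional projective space over $F$. Let $A=\{A_1,\ldots,A_{n+1}\}$ and $B=\{B_1,\ldots,B_{n+1}\}$ be two simplexes in $\Sigma_n$ in perspective from a vertex $V$ (with $A_i$ corresponding to $B_i$) which have no common points or faces. Then: (a) The intersection points of corresponding edges of $A$ and $B$ form a set $S$ of $\binom{n+1}{2}$ distinct points in $\Sigma_n$. None of these points lies in $A$ or in $B$ or is equal to $V$. (b) The intersection of corresponding $t$-spaces of $A,B$ is a $(t-1)$-dimensional subspace of $\Sigma_n$ for $t=1,2,\ldots,n-1$. (c) There is a fixed hyperplane $v$ of $\Sigma_n$ such that the intersection of any two corresponding faces of $A,B$ is an $(n-2)$-dimensional subspace which lies in $v$. (d) In particular, the set $S$ lies in $v$.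
   Context: Dimension means projective dimension. A simplex in $\Sigma_n$ is a set of $n+1$ points that generates $\Sigma_n$. An edge is the line joining two points of a simplex; a face is a hyperplane generated by $n$ of its points. $A,B$ are in perspective from the vertex (point) $V$ if there are $n+1$ lines through $V$, the $i$-th one containing $A_i$ and $B_i$, for $i=1,\ldots,n+1$. A $t$-space of $A$ is the $t$-dimensional subspace generated by $t+1$ points $A_i$, $i\in I$, $|I|=t+1$; the corresponding $t$-space of $B$ is generated by the points $B_i$, $i\in I$. Corresponding edges are the case $t=1$ and corresponding faces the case $t=n-1$.
   Formalization: In (a), that no point of S lies in A is claimed only when V is not a point of B, and that none lies in B only when V is not a point of A; if V = A_i, then every B_j with j ≠ i lies in S, so the unrestricted clause is false. *)

(* Defs.v *)
From HB Require Import structures.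
From mathcomp Require Import all_boot all_order all_algebra.
From mathcomp Require Import finmap.

Set Implicit Arguments.
Unset Strict Implicit.
Unset Printing Implicit Defensive.

Import GRing.Theory.

Local Open Scope ring_scope.

(* The projective subspaces of the n-dimensional projective space over F are
   the linear subspaces of F^(n+1); incidence is inclusion. *)
Notation subspace F n := {vspace 'rV[F]_n.+1}.

(* The zero vector space is the empty projective subspace, of dimension -1. *)
Definition pdim (F : fieldType) (n : nat) (U : subspace F n) : int :=
  (\dim U)%:Z - 1.

Definition is_point (F : fieldType) (n : nat) (U : subspace F n) : Prop :=
  pdim U = 0.

Definition is_line (F : fieldType) (n : nat) (U : subspace F n) : Prop :=
  pdim U = 1.

Definition is_hyperplane (F : fieldType) (n : nat) (U : subspace F n) : Prop :=
  pdim U = n%:Z - 1.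

Definition is_simplex (F : fieldType) (n : nat)
    (A : 'I_n.+1 -> subspace F n) : Prop :=
  [/\ forall i, is_point (A i), injective A & (\sum_i A i)%VS = fullv].

(* For a simplex A, this is a t-space of A when #|I| = t + 1; it is an edge when
   #|I| = 2 and a face when #|I| = n.  Spaces of A and B correspond when they
   have the same I. *)
Definition span_of (F : fieldType) (n : nat) (A : 'I_n.+1 -> subspace F n)
    (I : {set 'I_n.+1}) : subspace F n :=
  (\sum_(i in I) A i)%VS.

Definition in_perspective (F : fieldType) (n : nat) (V : subspace F n)
    (A B : 'I_n.+1 -> subspace F n) : Prop :=
  exists L : 'I_n.+1 -> subspace F n,
    forall i, [/\ is_line (L i), (V <= L i)%VS, (A i <= L i)%VS
                & (B i <= L i)%VS].

Definition no_common_point (F : fieldType) (n : nat)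
    (A B : 'I_n.+1 -> subspace F n) : Prop :=
  forall i j, A i <> B j.

Definition no_common_face (F : fieldType) (n : nat)
    (A B : 'I_n.+1 -> subspace F n) : Prop :=
  forall I J : {set 'I_n.+1}, #|I| = n -> #|J| = n ->
    span_of A I <> span_of B J.

Definition meet_of (F : fieldType) (n : nat) (A B : 'I_n.+1 -> subspace F n)
    (I : {set 'I_n.+1}) : subspace F n :=
  (span_of A I :&: span_of B I)%VS.

Definition edge_meets (F : fieldType) (n : nat)
    (A B : 'I_n.+1 -> subspace F n) : {fset subspace F n} :=
  [fset meet_of A B I | I in [pred I : {set 'I_n.+1} | #|I| == 2]]%fset.

(* Main.v *)
(* Let V = <v>.  Since no point is common to A and B, V cannot be a point of both
   simplexes; say V is not a point of B.  Then A_i = <a_i> for a vector a_i with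
   a_i - v in B_i, whether or not V is a point of A.  Hence a_i - a_j lies in
   A_i + A_j and in B_i + B_j, so corresponding spaces indexed by I both contain
   the span D_I of these differences, of vector dimension |I| - 1.  If they were
   equal for some nonempty I with |I| <= n, adjoining the a_j = a_i + (a_j - a_i)
   would propagate the equality to a common face; so they meet exactly in D_I.
   All D_I lie in the hyperplane spanned by all the differences. *)

Require Import Defs.
From HB Require Import structures.
From mathcomp Require Import all_boot all_order all_algebra.
From mathcomp Require Import finmap.

Set Implicit Arguments.
Unset Strict Implicit.
Unset Printing Implicit Defensive.

Import GRing.Theory.

Local Open Scope ring_scope.

(** * Points as one-dimensional vector spaces *)

Lemma dim_point (F : fieldType) (n : nat) (U : subspace F n) :
  is_point U <-> \dim U = 1%N.
Proof.
rewrite /is_point /pdim; split => [/eqP|->]; last by rewrite subrr.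
by rewrite subr_eq0 => /eqP [].
Qed.

Lemma point_eqP (F : fieldType) (n : nat) (U W : subspace F n) :
  is_point U -> is_point W -> (U <= W)%VS -> U = W.
Proof.
by move=> /dim_point dU /dim_point dW sUW; apply/eqP; rewrite eqEdim sUW dU dW.
Qed.

Lemma point_gen (F : fieldType) (n : nat) (U : subspace F n) (u : 'rV[F]_n.+1) :
  is_point U -> u \in U -> u != 0 -> U = <[u]>%VS.
Proof.
move=> pU uU u0; apply/esym/point_eqP => //.
by apply/dim_point; rewrite dim_vline u0.
Qed.

Lemma point_vline (F : fieldType) (n : nat) (U : subspace F n) :
  is_point U -> exists2 u, u != 0 & U = <[u]>%VS.
Proof.
move=> pU; have uU := memv_pick U.
have u0 : vpick U != 0.
  by rewrite vpick0 -dimv_eq0 (proj1 (dim_point U) pU).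
by exists (vpick U) => //; exact: point_gen.
Qed.

(** * Dimensions and intersections of spans of vertices *)

Section Spans.
Variables (F : fieldType) (n : nat).
Implicit Types (A B : 'I_n.+1 -> subspace F n) (I J : {set 'I_n.+1}).

Lemma leq_dim_sum (T : finType) (P : pred T) (U : T -> subspace F n) :
  (forall i, \dim (U i) <= 1)%N -> (\dim (\sum_(i | P i) U i)%VS <= #|P|)%N.
Proof.
move=> dU; apply: leq_trans (dimv_leq_sum _ _ _) _.
by rewrite -sum1_card; apply: leq_sum.
Qed.

Lemma spanS A I J : I \subset J -> (span_of A I <= span_of A J)%VS.
Proof.
by move=> /subsetP sIJ; apply/subv_sumP => i /sIJ iJ; exact: sumv_sup (subvv _).
Qed.

Lemma mem_span A I i x : i \in I -> x \in A i -> x \in span_of A I.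
Proof. by move=> iI xA; apply: subvP xA; exact: sumv_sup (subvv _). Qed.

Lemma spanU A I J : (span_of A I + span_of A J)%VS = span_of A (I :|: J).
Proof.
apply/eqP; rewrite eqEsubv subv_add !spanS ?subsetUl ?subsetUr //=.
apply/subv_sumP => i /setUP[] iI.
  by apply: subv_trans (addvSl _ _); exact: sumv_sup (subvv _).
by apply: subv_trans (addvSr _ _); exact: sumv_sup (subvv _).
Qed.

Lemma span1 A i : span_of A [set i] = A i.
Proof. by rewrite /span_of big_set1. Qed.

(** Any span has dimension at most its number of vertices. The spans over [I] and [~: I] together
    fill a space of dimension [n.+1], so neither bound can be strict. *)
Lemma dim_span A I : is_simplex A -> \dim (span_of A I) = #|I|.
Proof.
case=> pA _ fullA.
have le J : (\dim (span_of A J) <= #|J|)%N.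
  by apply: leq_dim_sum => i; rewrite (proj1 (dim_point _) (pA i)).
apply/eqP; rewrite eqn_leq le -(leq_add2r #|~: I|) cardsC card_ord.
apply: leq_trans (leq_add (leqnn _) (le (~: I))).
apply: leq_trans (dimv_add_leqif _ _).
rewrite spanU setUCr /span_of (eq_bigl predT) => [|i]; last by rewrite inE.
by rewrite fullA dimvf /dim /= mul1n.
Qed.

(** The inclusion from right to left is clear; Grassmann's formula and [cardsUI] give both sides the
    same dimension. *)
Lemma span_cap A I J :
  is_simplex A -> (span_of A I :&: span_of A J)%VS = span_of A (I :&: J).
Proof.
move=> sA; apply/esym/eqP.
rewrite eqEdim subv_cap !spanS ?subsetIl ?subsetIr //=.
rewrite -(leq_add2l (\dim (span_of A (I :|: J)))) -{1}spanU dimv_sum_cap.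
by rewrite !dim_span // cardsUI.
Qed.

End Spans.

(** * Meets of corresponding spaces, for vectors [a i] normalized against [v] *)

Section Aligned.
Variables (F : fieldType) (n : nat).
Variables (A B : 'I_n.+1 -> subspace F n) (V : subspace F n).
Variables (a : 'I_n.+1 -> 'rV[F]_n.+1) (v : 'rV[F]_n.+1).
Hypothesis n_ge2 : (2 <= n)%N.
Hypotheses (simplexA : is_simplex A) (simplexB : is_simplex B).
Hypothesis no_face : no_common_face A B.
Hypothesis defA : forall i, A i = <[a i]>%VS.
Hypothesis a_sub_v : forall i, a i - v \in B i.

Lemma vertex_mem i : a i \in A i.
Proof. by rewrite defA memv_line. Qed.

(** The space $D_I$, generated by differences from a base index [i]. For [i] in [I] this leaves
    [#|I|.-1] generators, and the choice of base does not change the space. *)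
Definition difference_span (I : {set 'I_n.+1}) (i : 'I_n.+1) : subspace F n :=
  (\sum_(j in I :\ i) <[a j - a i]>)%VS.

Lemma mem_difference_span (I : {set 'I_n.+1}) i j : j \in I -> a j - a i \in difference_span I i.
Proof.
move=> jI; have [->|ji] := eqVneq j i; first by rewrite subrr mem0v.
by rewrite memvE (sumv_sup j) // !inE ji.
Qed.

(** Counting generators bounds the dimension above. Adjoining the single vector [a i] recovers every
    [a j] with [j] in [I], which bounds it below. *)
Lemma dim_difference_span (I : {set 'I_n.+1}) i :
  i \in I -> \dim (difference_span I i) = #|I|.-1.
Proof.
move=> iI; apply/eqP; rewrite eqn_leq; apply/andP; split.
  rewrite (cardsD1 i I) iI /=.
  by apply: leq_dim_sum => j; rewrite dim_vline; case: (_ != _).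
rewrite -subn1 leq_subLR addnC -(dim_span I simplexA).
apply: (@leq_trans (\dim (difference_span I i + <[a i]>)%VS)).
  apply/dimvS/subv_sumP => j jI; rewrite defA -memvE -[a j](subrK (a i)).
  by rewrite memv_add ?memv_line // mem_difference_span.
apply: leq_trans (dimv_add_leqif _ _) _.
by rewrite leq_add2l dim_vline; case: (_ != _).
Qed.

(** On the side of [B], write [a j - a i] as [(a j - v) - (a i - v)]. *)
Lemma difference_span_sub (I : {set 'I_n.+1}) i :
  i \in I -> (difference_span I i <= meet_of A B I)%VS.
Proof.
move=> iI; apply/subv_sumP => j /setD1P[_ jI].
rewrite -memvE memv_cap; apply/andP; split.
  by rewrite memvB // (mem_span _ (vertex_mem _)).
rewrite -[a j](subrK v) -addrA -[v - a i]opprB.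
by rewrite memvB // (mem_span _ (a_sub_v _)).
Qed.

Lemma span_neq (I : {set 'I_n.+1}) :
  (0 < #|I| <= n)%N -> span_of A I <> span_of B I.
Proof.
case/andP=> /card_gt0P[i iI] cI eqAB.
(* Enlarge [I] to the index set of a face by omitting one index outside [I]. *)
have [J sIJ cJ] : exists2 J : {set 'I_n.+1}, I \subset J & #|J| = n.
  have [k kI] : exists k, k \notin I.
    apply/existsP; rewrite -negb_forall; apply/negP => /forallP IT.
    have : (#|[set: 'I_n.+1]| <= #|I|)%N by apply/subset_leq_card/subsetP.
    by rewrite cardsT card_ord leqNgt ltnS cI.
  exists [set~ k]; last by rewrite cardsC1 card_ord.
  by apply/subsetP => j jI; rewrite !inE; apply: contraNneq kI => <-.
apply: (no_face cJ cJ); apply/eqP; rewrite eqEdim !dim_span // leqnn andbT.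
have aiB : a i \in span_of B J.
  by apply: subvP (spanS B sIJ) _ _; rewrite -eqAB (mem_span _ (vertex_mem _)).
apply/subv_sumP => j jJ; rewrite defA -memvE -[a j](subrK (a i)) memvD //.
have iJ := subsetP sIJ _ iI.
apply: subvP (capvSr (span_of A J) _) _ _.
apply: subvP (difference_span_sub iJ) _ _.
exact: mem_difference_span.
Qed.

(** If the meet were larger than $D_I$, it would have dimension [#|I|] and thus equal both spans,
    against [span_neq]. *)
Lemma meetE (I : {set 'I_n.+1}) i :
  i \in I -> (#|I| <= n)%N -> meet_of A B I = difference_span I i.
Proof.
move=> iI cI; have I_gt0 : (0 < #|I|)%N by apply/card_gt0P; exists i.
apply/esym/eqP; rewrite eqEdim difference_span_sub //= dim_difference_span //.
rewrite -ltnS prednK // ltnNge; apply/negP => dI.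
have IP : (0 < #|I| <= n)%N by rewrite I_gt0.
apply: (span_neq IP); transitivity (meet_of A B I); apply/eqP.
  by rewrite eq_sym eqEdim capvSl dim_span.
by rewrite eqEdim capvSr dim_span.
Qed.

Lemma dim_meet (I : {set 'I_n.+1}) :
  (0 < #|I| <= n)%N -> \dim (meet_of A B I) = #|I|.-1.
Proof.
by case/andP=> /card_gt0P[i iI] cI; rewrite (meetE iI cI) dim_difference_span.
Qed.

Lemma meet_sub (I : {set 'I_n.+1}) k :
  (0 < #|I| <= n)%N -> (meet_of A B I <= difference_span setT k)%VS.
Proof.
case/andP=> /card_gt0P[i iI] cI; rewrite (meetE iI cI).
apply/subv_sumP => j _; rewrite -memvE -[a j](subrK (a k)) -addrA.
by rewrite -[a k - _]opprB memvB // mem_difference_span.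
Qed.

Lemma edge_bounds (I : {set 'I_n.+1}) : #|I| = 2 -> (0 < #|I| <= n)%N.
Proof. by move=> ->. Qed.

Lemma edge_meet_point (I : {set 'I_n.+1}) :
  #|I| = 2 -> is_point (meet_of A B I).
Proof.
by move=> cI; apply/dim_point; rewrite dim_meet ?edge_bounds // cI.
Qed.

(** If the meet is [A i], then [span_cap] forces [i] into [I]. For the other index [k], both
    [a k - a i] and [a i] lie in [A i], so [A k = A i]. *)
Lemma edge_meet_neq_vertex (I : {set 'I_n.+1}) i :
  #|I| = 2 -> meet_of A B I <> A i.
Proof.
move=> cI eqM; have [pA injA _] := simplexA.
have iI : i \in I.
  apply/negPn/negP => iI.
  have : (A i <= span_of A (I :&: [set i]))%VS.
    by rewrite -span_cap // subv_cap span1 subvv andbT -eqM capvSl.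
  move/dimvS; rewrite dim_span // (proj1 (dim_point _) (pA i)).
  suff -> : I :&: [set i] = set0 by rewrite cards0.
  by apply/disjoint_setI0; rewrite disjoint_sym disjoints1.
have [k] : exists k, k \in I :\ i.
  by apply/card_gt0P; move/eqP: cI; rewrite (cardsD1 i) iI add1n eqSS => /eqP->.
case/setD1P=> ki kI; move/eqP: ki; apply; apply: injA.
apply: point_eqP => //; rewrite (defA k) -memvE -[a k](subrK (a i)) memvD //;
  last exact: vertex_mem.
by rewrite -eqM (meetE iI) ?cI // mem_difference_span.
Qed.

(** If [v] lay in the span of [B] over [I], so would each [a i = (a i - v) + v], and the two edges
    would coincide. *)
Lemma edge_meet_neq_center (I : {set 'I_n.+1}) :
  #|I| = 2 -> meet_of A B I <> <[v]>%VS.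
Proof.
move=> cI eqM; apply: (span_neq (edge_bounds cI)).
apply/eqP; rewrite eqEdim !dim_span // leqnn andbT.
apply/subv_sumP => i iI; rewrite defA -memvE -[a i](subrK v).
rewrite memvD ?(mem_span iI (a_sub_v i)) //.
have : v \in meet_of A B I by rewrite eqM memv_line.
by rewrite memv_cap => /andP[].
Qed.

(** Distinct pairs share at most one index. A common meet lies in the span of [A] over [I :&: J], so
    it would be a vertex of [A]. *)
Lemma edge_meet_inj (I J : {set 'I_n.+1}) :
  #|I| = 2 -> #|J| = 2 -> meet_of A B I = meet_of A B J -> I = J.
Proof.
move=> cI cJ eqM; apply/eqP/negPn/negP => neqIJ.
have cIJ : (#|I :&: J| <= 1)%N.
  rewrite leqNgt; apply/negP => c2; move/eqP: neqIJ; apply.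
  transitivity (I :&: J); apply/eqP.
    by rewrite eq_sym eqEcard subsetIl cI.
  by rewrite eqEcard subsetIr cJ.
have sub : (meet_of A B I <= span_of A (I :&: J))%VS.
  by rewrite -span_cap // subv_cap {2}eqM !capvSl.
have dM := proj1 (dim_point _) (edge_meet_point cI).
have : #|I :&: J| == 1%N.
  by rewrite eqn_leq cIJ -(dim_span _ simplexA); move/dimvS: sub; rewrite dM.
case/cards1P=> i eqi; apply: (@edge_meet_neq_vertex I i cI).
have [pA _ _] := simplexA.
by apply: point_eqP; [exact: edge_meet_point | exact: pA | rewrite -(span1 A) -eqi].
Qed.

End Aligned.

(* For [U = A i] and [W = B i]: [V <> B i] makes [V] and [B i] span [L i], and
   [A i <> B i] makes the [V]-component of [A i] nonzero, so it can be
   normalized to [v]; this covers [V = A i]. *)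
Lemma aligned_vertices (F : fieldType) (n : nat) (L U W : subspace F n)
    (v : 'rV[F]_n.+1) :
  v != 0 -> is_line L -> is_point U -> is_point W ->
  (<[v]> <= L)%VS -> (U <= L)%VS -> (W <= L)%VS -> U <> W -> <[v]>%VS <> W ->
  exists2 u, U = <[u]>%VS & u - v \in W.
Proof.
move=> v0 lineL pU pW vL UL WL neqUW neqvW.
have pv : is_point <[v]>%VS by apply/dim_point; rewrite dim_vline v0.
have dL : \dim L = 2%N by move/eqP: lineL; rewrite subr_eq => /eqP[].
have capvW : (<[v]> :&: W)%VS = 0%VS.
  apply/eqP; rewrite -dimv_eq0; apply/negPn/negP; rewrite -lt0n => d_gt0.
  have dcap : (\dim <[v]> <= \dim (<[v]> :&: W))%N by rewrite dim_vline v0.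
  apply: neqvW; apply: point_eqP => //.
  have /eqP <- : (<[v]> :&: W == <[v]>)%VS by rewrite eqEdim capvSl.
  exact: capvSr.
have eqL : (<[v]> + W)%VS = L.
  apply/eqP; rewrite eqEdim subv_add vL WL dL dimv_disjoint_sum //.
  by rewrite (proj1 (dim_point _) pv) (proj1 (dim_point _) pW).
have [u u0 defU] := point_vline pU.
have : u \in L by apply: subvP UL _ _; rewrite defU memv_line.
rewrite -eqL => /memv_addP[_ /vlineP[k ->] [w wW eq_u]].
have k0 : k != 0.
  apply: contra_not_neq neqUW => k0; apply: point_eqP => //.
  by rewrite defU -memvE eq_u k0 scale0r add0r.
exists (k^-1 *: u).
  apply: point_gen => //; first by rewrite defU memvZ ?memv_line.
  by rewrite scaler_eq0 invr_eq0 (negPf k0).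
by rewrite eq_u scalerDr scalerA mulVf // scale1r addrAC subrr add0r memvZ.
Qed.

Lemma simplex_aligned (F : fieldType) (n : nat)
    (A B : 'I_n.+1 -> subspace F n) (v : 'rV[F]_n.+1) :
  v != 0 -> is_simplex A -> is_simplex B -> in_perspective <[v]>%VS A B ->
  no_common_point A B -> (forall i, <[v]>%VS <> B i) ->
  exists a : 'I_n.+1 -> 'rV[F]_n.+1,
    forall i, A i = <[a i]>%VS /\ a i - v \in B i.
Proof.
move=> v0 [pA _ _] [pB _ _] [L perspL] no_point neqvB.
have /fin_all_exists : forall i, exists u, A i = <[u]>%VS /\ u - v \in B i.
  move=> i; have [lineL vL AL BL] := perspL i.
  by have [u] := aligned_vertices v0 lineL (pA i) (pB i) vL AL BL
    (no_point i i) (neqvB i); exists u.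
exact.
Qed.

(** * Exchange of the two simplexes, and the set of edge meets *)

Lemma meet_ofC (F : fieldType) (n : nat) (A B : 'I_n.+1 -> subspace F n) I :
  meet_of A B I = meet_of B A I.
Proof. exact: capvC. Qed.

Lemma edge_meetsC (F : fieldType) (n : nat) (A B : 'I_n.+1 -> subspace F n) :
  edge_meets A B = edge_meets B A.
Proof. by apply: eq_in_imfset => // I _; exact: capvC. Qed.

Lemma edge_meetsP (F : fieldType) (n : nat) (A B : 'I_n.+1 -> subspace F n) P :
  P \in edge_meets A B ->
  exists2 I : {set 'I_n.+1}, #|I| = 2 & P = meet_of A B I.
Proof. by case/imfsetP => I /= /eqP cI ->; exists I. Qed.

Lemma in_perspectiveC (F : fieldType) (n : nat) (V : subspace F n)
    (A B : 'I_n.+1 -> subspace F n) :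
  in_perspective V A B -> in_perspective V B A.
Proof. by case=> L perspL; exists L => i; case: (perspL i). Qed.

Lemma card_edge_meets (F : fieldType) (n : nat)
    (A B : 'I_n.+1 -> subspace F n) :
  (forall I J : {set 'I_n.+1}, #|I| = 2 -> #|J| = 2 ->
     meet_of A B I = meet_of A B J -> I = J) ->
  #|` edge_meets A B|%fset = 'C(n.+1, 2).
Proof.
move=> injM; rewrite /edge_meets card_in_imfset /=; last first.
  by move=> I J /eqP cI /eqP cJ; exact: injM.
rewrite -[in RHS](card_ord n.+1) -card_draws -cardE.
by apply: eq_card => I; rewrite !inE.
Qed.

(** The normalization treats [A] and [B] differently, so only vertices of [A] are excluded from the
    edge meets here; those of [B] require exchanging the simplexes. *)
Lemma desargues_off_center (F : fieldType) (n : nat)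
    (A B : 'I_n.+1 -> subspace F n) (V : subspace F n) :
  (2 <= n)%N -> is_simplex A -> is_simplex B -> is_point V ->
  in_perspective V A B -> no_common_point A B -> no_common_face A B ->
  (forall i, V <> B i) ->
  [/\ #|` edge_meets A B|%fset = 'C(n.+1, 2),
      forall P, P \in edge_meets A B -> is_point P,
      forall P, P \in edge_meets A B -> P <> V
    & forall P, P \in edge_meets A B -> forall i, P <> A i] /\
  (forall I : {set 'I_n.+1}, (0 < #|I| <= n)%N ->
     \dim (meet_of A B I) = #|I|.-1) /\
  (exists2 H : subspace F n, is_hyperplane H &
     forall I : {set 'I_n.+1}, (0 < #|I| <= n)%N -> (meet_of A B I <= H)%VS).
Proof.
move=> n_ge2 sA sB pV perspAB no_point no_face neqVB.
have [v v0 defV] := point_vline pV; subst V.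
have [a a_ok] := simplex_aligned v0 sA sB perspAB no_point neqVB.
have defA i := proj1 (a_ok i); have av i := proj2 (a_ok i).
split; [split|split].
- apply: card_edge_meets => I J.
  exact: (edge_meet_inj n_ge2 sA sB no_face defA av).
- move=> P /edge_meetsP[I cI ->].
  exact: (edge_meet_point n_ge2 sA sB no_face defA av).
- move=> P /edge_meetsP[I cI ->].
  exact: (edge_meet_neq_center n_ge2 sA sB no_face defA av).
- move=> P /edge_meetsP[I cI ->] i.
  exact: (edge_meet_neq_vertex n_ge2 sA sB no_face defA av).
- exact: (dim_meet sA sB no_face defA av).
(* The hyperplane is $D_I$ for the full index set, of vector dimension [n]; the base [ord0] is
   arbitrary. *)
- exists (difference_span a setT ord0); last first.
    by move=> I; exact: (meet_sub sA sB no_face defA av).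
  by rewrite /is_hyperplane /pdim (dim_difference_span sA defA) ?inE // cardsT card_ord.
Qed.

(* If V is a vertex of A (resp. of B), some points of S are vertices of B
   (resp. of A); this is the only part of the theorem that then fails, hence the
   two premises on V in (a). *)
Theorem theorem3p4 (F : fieldType) (n : nat)
    (A B : 'I_n.+1 -> subspace F n) (V : subspace F n)
    (n_ge2 : (2 <= n)%N)
    (F_gt2 : exists s : seq F, uniq s && (2 < size s)%N)
    (simplexA : is_simplex A) (simplexB : is_simplex B)
    (pointV : is_point V)
    (perspAB : in_perspective V A B)
    (no_point : no_common_point A B)
    (no_face : no_common_face A B) :
  (* (a) *)
  [/\ #|` edge_meets A B|%fset = 'C(n.+1, 2),
      forall P, P \in edge_meets A B -> is_point P,
      forall P, P \in edge_meets A B -> P <> V,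
      (forall i, V <> B i) ->
        forall P, P \in edge_meets A B -> forall i, P <> A i
    & (forall i, V <> A i) ->
        forall P, P \in edge_meets A B -> forall i, P <> B i] /\
  (* (b) *)
  (forall (t : nat) (I : {set 'I_n.+1}), (1 <= t <= n - 1)%N -> #|I| = t.+1 ->
     pdim (meet_of A B I) = t%:Z - 1) /\
  (* (c) and (d) *)
  (exists v : subspace F n,
     [/\ is_hyperplane v,
         forall I : {set 'I_n.+1}, #|I| = n ->
           pdim (meet_of A B I) = n%:Z - 2 /\ (meet_of A B I <= v)%VS
       & forall P, P \in edge_meets A B -> (P <= v)%VS]).
Proof.
(* The conclusion is symmetric in [A] and [B]. If [V] is a vertex of [B], it is none of [A], and the
   simplexes can be exchanged. *)
wlog neqVB : A B simplexA simplexB perspAB no_point no_face / forall i, V <> B i.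
  move=> wlogB.
  have [/existsP[i /eqP VB]|] := boolP [exists i, V == B i]; last first.
    by rewrite negb_exists => /forallP neqVB; apply: wlogB => // i; apply/eqP.
  have no_point' : no_common_point B A by move=> j k /esym; exact: no_point.
  have no_face' : no_common_face B A by move=> I J cI cJ /esym; exact: no_face.
  have neqVA j : V <> A j by rewrite VB => /esym; exact: no_point.
  have := wlogB B A simplexB simplexA (in_perspectiveC perspAB) no_point' no_face' neqVA.
  rewrite (edge_meetsC B A); case=> -[cS pS VS BS AS] [dimM [H [hypH subH SH]]].
  split; first by split.
  split=> [t I|]; first by rewrite meet_ofC; exact: dimM.
  by exists H; split=> // I; rewrite meet_ofC; exact: subH.
have [[cS pS VS SA] [dimM [H hypH subH]]] :=
  desargues_off_center n_ge2 simplexA simplexB pointV perspAB no_point no_face neqVB.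
split; [split=> // neqVA|split].
(* With [V] also off [A], the exchanged simplexes exclude the vertices of [B]. *)
- have no_point' : no_common_point B A by move=> j k /esym; exact: no_point.
  have no_face' : no_common_face B A by move=> I J cI cJ /esym; exact: no_face.
  have [[_ _ _]] := desargues_off_center n_ge2 simplexB simplexA pointV
    (in_perspectiveC perspAB) no_point' no_face' neqVA.
  by rewrite edge_meetsC.
- move=> t I /andP[t_gt0 t_lt] cI; rewrite /pdim dimM cI //.
  by move: n_ge2 t_lt; case: (n) => // m _; rewrite subn1.
- exists H; split=> // [I cI|P /edge_meetsP[I cI ->]].
    have I_ok : (0 < #|I| <= n)%N by rewrite cI leqnn (ltnW n_ge2).
    split; last exact: subH.
    rewrite /pdim dimM // cI.
    by move: n_ge2; case: (n) => // m _; rewrite /= -addn1 PoszD -addrA.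
  by apply: subH; rewrite cI.
Qed.
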